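(* Let $p$ be a fixed positive integer and for all $i\in\{0,\ldots,p-1\}$, let $\mathbf{a}_i=a_{i,1}a_{i,2}\cdots$ be an infinite sequence of non-negative integers lexicographically greater than $10^\omega$. Assume moreover that for all $i\in\{0,\ldots,p-1\}$: if $\mathbf{a}_i$ ends in $0^\omega$ then \[ a_{i,j+1}a_{i,j+2}\cdots <_{\mathrm{lex}} \mathbf{a}_{i-j}\quad\text{for all } j\ge 1, \] and if $\mathbf{a}_i$ does not end in $0^\omega$ then \[ a_{i,j+1}a_{i,j+2}\cdots \le_{\mathrm{lex}} \mathbf{a}_{i-j}\quad\text{for all } j\ge 1, \] where the index in $\mathbf{a}_{i-j}$ is considered modulo $p$. Then there exists an alternate base $B$ of length $p$ such that $\mathbf{t}_i=\mathbf{a}_i$ for all $i\in\{0,\ldots,p-1\}$ such that $\mathbf{a}_i$ ends in $0^\omega$, and $\mathbf{d}_i=\mathbf{a}_i$ for all $i\in\{0,\ldots,p-1\}$ such that $\mathbf{a}_i$ does not end in $0^\omega$, where $\mathbf{t}_i$ and $\mathbf{d}_i$ denote the greedy and quasi-greedy $S^i(B)$-expansions of $1$. Moreover, the following uniqueness properties hold. (1) If $\mathbf{a}_0,\ldots,\mathbf{a}_{p-1}$ are all ultimately periodic, then the base $B$ (among alternate bases of length $p$ such that $\mathbf{t}_i=\mathbf{a}_i$ for all $i\in\{0,\ldots,p-1\}$ such that $\mathbf{a}_i$ ends in $0^\omega$, and $\mathbf{d}_i=\mathbf{a}_i$ for all $i\in\{0,\ldots,p-1\}$ such that $\mathbf{a}_i$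 does not end in $0^\omega$) is unique. (2) If $\mathbf{a}_0,\ldots,\mathbf{a}_{p-1}$ all start with a digit that is greater than $1$, then the base $B$ (among alternate bases of length $p$ such that $\mathbf{t}_i=\mathbf{a}_i$ for all $i\in\{0,\ldots,p-1\}$ such that $\mathbf{a}_i$ ends in $0^\omega$, and $\mathbf{d}_i=\mathbf{a}_i$ for all $i\in\{0,\ldots,p-1\}$ such that $\mathbf{a}_i$ does not end in $0^\omega$) is unique.
   Context: A Cantor real base is a bi-infinite sequence $B=(\beta_n)_{n\in\mathbb{Z}}$ of real numbers $\beta_n>1$ with $\prod_{n=1}^{+\infty}\beta_n=\prod_{n=1}^{+\infty}\beta_{-n}=+\infty$. For $n\in\mathbb{Z}$, $S^n(B)=(\beta_{m+n})_{m\in\mathbb{Z}}$. For a one-sided infinite sequence $\mathbf{a}=a_1a_2\cdots$ of non-negative integers, $\mathrm{val}_{S^n(B)}(0\bullet\mathbf{a})=\sum_{j=1}^{+\infty}\frac{a_j}{\beta_{n-1}\beta_{n-2}\cdots\beta_{n-j}}$. An alternate base of length $p\ge 1$ is a Cantor real base $B$ with $S^p(B)=B$ (i.e. $p$-periodic; $p$ need not be the least period); it is written $B=(\beta_{p-1},\ldots,\beta_0)$. For $n\in\mathbb{Z}$, the greedy $S^n(B)$-expansion of $1$, denoted $\mathbf{t}_n$, is the lexicographically greatest infinite sequence $\mathbf{t}$ of non-negative integers with $\mathrm{val}_{S^n(B)}(0\bullet\mathbf{t})=1$. The quasi-greedy $S^n(B)$-expansion of $1$, denoted $\mathbf{d}_n$,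 is the lexicographically greatest infinite sequence $\mathbf{d}$ of non-negative integers not ending in a tail of zeros with $\mathrm{val}_{S^n(B)}(0\bullet\mathbf{d})=1$. $0^\omega$ is the constant infinite sequence of zeros and $10^\omega=1000\cdots$; a sequence ends in $0^\omega$ (in a tail of zeros) if all but finitely many of its terms are $0$. $<_{\mathrm{lex}}$ and $\le_{\mathrm{lex}}$ denote the lexicographic order on infinite sequences of non-negative integers. *)

(* Defs.v *)
From HB Require Import structures.
From mathcomp Require Import all_boot all_order all_algebra.
From mathcomp Require Import all_classical all_reals all_analysis.
Set Implicit Arguments.
Unset Strict Implicit.
Unset Printing Implicit Defensive.
Import Order.TTheory GRing.Theory Num.Theory.
Import numFieldNormedType.Exports.
Local Open Scope classical_set_scope.
Local Open Scope ring_scope.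

(* An infinite sequence of digits a_1 a_2 a_3 ... is a function [nat -> nat];
   it is indexed from 0, so that [a j] is the digit a_{j+1}. *)

Definition lex_lt (a b : nat -> nat) : Prop :=
  exists n : nat, (forall k : nat, (k < n)%N -> a k = b k) /\ (a n < b n)%N.

Definition lex_le (a b : nat -> nat) : Prop := lex_lt a b \/ a = b.

Definition ends_in_zeros (a : nat -> nat) : Prop :=
  exists N : nat, forall k : nat, (N <= k)%N -> a k = 0%N.

Definition ultimately_periodic (a : nat -> nat) : Prop :=
  exists N q : nat,
    (0 < q)%N /\ forall k : nat, (N <= k)%N -> a (k + q)%N = a k.

(* The sequence a_{j+1} a_{j+2} ... *)
Definition seq_tail (j : nat) (a : nat -> nat) : nat -> nat :=
  fun k => a (j + k)%N.

(* The sequence 1 0 0 0 ... *)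
Definition one_zeros : nat -> nat := fun k => if k is 0%N then 1%N else 0%N.

Definition cantor_real_base (R : realType) (B : int -> R) : Prop :=
  [/\ forall n : int, 1 < B n,
      \prod_(1 <= k < N.+1) B k%:Z @[N --> \oo] --> +oo
    & \prod_(1 <= k < N.+1) B (- k%:Z) @[N --> \oo] --> +oo].

Definition shift_base (R : realType) (n : int) (B : int -> R) : int -> R :=
  fun m => B (m + n).

Definition alternate_base (R : realType) (p : nat) (B : int -> R) : Prop :=
  cantor_real_base B /\ shift_base p%:Z B = B.

(* The value of 0 . a_1 a_2 ... in base B, that is, the sum over j >= 1 of
   a_j / (B_{-1} B_{-2} ... B_{-j}); it is +oo when the series diverges. *)
Definition val_frac (R : realType) (B : int -> R) (a : nat -> nat) : \bar R :=
  (\sum_(0 <= j <oo)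
    ((a j)%:R / \prod_(1 <= k < j.+2) B (- k%:Z))%:E)%E.

Definition is_greedy_expansion_of_1 (R : realType) (B : int -> R)
    (t : nat -> nat) : Prop :=
  val_frac B t = 1%E /\
  forall s : nat -> nat, val_frac B s = 1%E -> lex_le s t.

Definition is_quasi_greedy_expansion_of_1 (R : realType) (B : int -> R)
    (d : nat -> nat) : Prop :=
  [/\ ~ ends_in_zeros d,
      val_frac B d = 1%E
    & forall s : nat -> nat,
        ~ ends_in_zeros s -> val_frac B s = 1%E -> lex_le s d].

Definition has_prescribed_expansions (R : realType) (p : nat)
    (a : 'I_p -> nat -> nat) (B : int -> R) : Prop :=
  alternate_base p B /\
  forall i : 'I_p,
    (ends_in_zeros (a i) ->
      is_greedy_expansion_of_1 (shift_base i%:Z B) (a i)) /\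
    (~ ends_in_zeros (a i) ->
      is_quasi_greedy_expansion_of_1 (shift_base i%:Z B) (a i)).

(* Main.v *)
Require Import Defs.
From HB Require Import structures.
From mathcomp Require Import all_boot all_order all_algebra.
From mathcomp Require Import all_classical all_reals all_analysis.
From mathcomp Require Import ring lra zify.
Set Implicit Arguments.
Unset Strict Implicit.
Unset Printing Implicit Defensive.
Import Order.TTheory GRing.Theory Num.Theory.
Import numFieldNormedType.Exports.
Local Open Scope ring_scope.
Local Open Scope classical_set_scope.

(* Put [y m = 1 / (B_{-1} ... B_{-m})] and [b m = a_{-m mod p}]. The sequences [a_i]
   represent 1 in all shifts of [B] iff [y m] is the sum of the [b m j * y (m + j + 1)]
   for every [m], and [y] is quasi-periodic: [y (m + p) = s * y m]. So [B] corresponds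
   to a Perron-Frobenius eigenvector.

   Existence: among the positive quasi-periodic [y] for which these sums are at most
   [y m], one with the largest [s] exists by compactness. If one of its inequalities
   were strict, perturbing [y] would make all of them strict, and [s] could be
   increased. Since [a_i] is greater than [10^omega], such a [y] is strictly
   decreasing, which means that [B > 1].

   Greediness: by the lexicographic conditions, the tail of a series bounds the weight
   at which it starts, up to the same defect at a later index, and this defect vanishes
   in the limit.

   Uniqueness holds under no extra condition: for two solutions with [s' <= s], the
   ratio [y' / y] attains its maximum at some index, and equality there propagates to
   all later indices. *)

(** * Partial sums and the lexicographic order *)

Definition psum (R : realType) (y : nat -> R) (m : nat) (c : nat -> nat) (n : nat) : R :=
  \sum_(j < n) (c j)%:R * y (m + j.+1)%N.

(** For nonnegative [y], the series of the [c j * y (m + j + 1)] has sum [y m]. The supremum form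
    lets each half be used on partial sums alone. *)
Definition represents (R : realType) (y : nat -> R) (m : nat) (c : nat -> nat) :=
  (forall n, psum y m c n <= y m) /\
  forall e, 0 < e -> exists n, y m - e < psum y m c n.

Lemma psumS (R : realType) (y : nat -> R) m c n :
  psum y m c n.+1 = psum y m c n + (c n)%:R * y (m + n.+1)%N.
Proof. by rewrite /psum big_ord_recr. Qed.

Lemma psumD (R : realType) (y : nat -> R) m c i n :
  psum y m c (i + n) = psum y m c i + psum y (m + i) (seq_tail i c) n.
Proof.
rewrite /psum big_split_ord /=; congr (_ + _); apply: eq_bigr => j _.
by rewrite /seq_tail !addnS addnA.
Qed.

Lemma psum_le (R : realType) (y : nat -> R) m c n n' :
  (forall k, 0 <= y k) -> (n <= n')%N -> psum y m c n <= psum y m c n'.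
Proof.
move=> y0 /subnKC <-; rewrite psumD lerDl.
by apply: sumr_ge0 => j _; rewrite mulr_ge0.
Qed.

Lemma eq_psum (R : realType) (y : nat -> R) m c c' n :
  (forall k, (k < n)%N -> c k = c' k) -> psum y m c n = psum y m c' n.
Proof. by move=> cc'; apply: eq_bigr => j _; rewrite cc'. Qed.

(* The remainder of the series after [i] terms, minus the weight at which it starts. *)
Definition excess (R : realType) (y : nat -> R) m c i : R :=
  y m - psum y m c i - y (m + i)%N.

(** At the first difference the digit of [c] is smaller by at least one unit, which leaves room for
    an extra weight [y (m + i')] in the partial sum of [b]. That sum is at most [y (m + i)], so the
    excess does not drop from [i] to [i']. *)
Lemma excess_lt (R : realType) (y : nat -> R) m c b i :
  (forall k, 0 <= y k) -> represents y (m + i) b -> lex_lt (seq_tail i c) b ->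
  exists2 i', (i < i')%N & excess y m c i <= excess y m c i'.
Proof.
move=> y0 [bm _] [n [eqn ltn]]; exists (i + n.+1)%N; first by lia.
have := bm n.+1; rewrite /excess psumD !psumS (eq_psum _ _ eqn) addnA => H.
suff : (seq_tail i c n)%:R * y (m + i + n.+1)%N + y (m + i + n.+1)%N <=
    (b n)%:R * y (m + i + n.+1)%N by lra.
by rewrite -[X in _ + X]mul1r -mulrDl natr1 ler_wpM2r// ler_nat.
Qed.

Lemma excess_eq (R : realType) (y : nat -> R) m c i :
  (forall k, 0 <= y k) -> represents y m c ->
  represents y (m + i) (seq_tail i c) -> excess y m c i <= 0.
Proof.
move=> y0 [_ cm] [bm _]; rewrite subr_le0; apply/ler_addgt0Pr => e e0.
have [n ltn] := cm _ e0; rewrite lerBlDl addrA.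
apply: le_trans (_ : psum y m c (i + n) + e <= _).
  by rewrite -lerBlDr ltW// (lt_le_trans ltn)// psum_le// leq_addl.
by rewrite psumD lerD2r lerD2l.
Qed.

Lemma nondecreasing_along (R : realType) (D : nat -> R) i :
  (forall i, (0 < i)%N -> exists2 i', (i < i')%N & D i <= D i') -> (0 < i)%N ->
  forall n, exists2 i', (n < i')%N & D i <= D i'.
Proof.
move=> stepD i0; elim=> [|n [i' ni' lei']]; first by exists i.
have [j ij lej] := stepD _ (leq_ltn_trans (leq0n n) ni').
by exists j; [exact: leq_ltn_trans ij | exact: le_trans lej].
Qed.

(** A positive excess would carry over to arbitrarily late indices, whereas it is bounded by the
    remainder of the series, which tends to 0. *)
Lemma excess_le0 (R : realType) (y : nat -> R) (b : nat -> nat -> nat) m c i :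
  (forall k, 0 <= y k) -> represents y m c ->
  (forall i, represents y i (b i)) ->
  (forall i, (0 < i)%N -> lex_le (seq_tail i c) (b (m + i)%N)) ->
  (0 < i)%N -> excess y m c i <= 0.
Proof.
move=> y0 cm bm cb i0; rewrite leNgt; apply/negP => e0.
have [n ltn] := cm.2 _ e0.
(* When the tail equals [b (m + j)], only [excess <= 0] is known; truncating at 0 makes the
   transport work in that case too. *)
have [|j nj] := @nondecreasing_along _
  (fun j => Num.max 0 (excess y m c j)) i _ i0 n.
  move=> j j0; have [lt_cb|eq_cb] := cb _ j0.
    have [j' jj' lej'] := excess_lt y0 (bm _) lt_cb.
    by exists j' => //; rewrite ge_max !le_max lexx lej' orbT.
  exists j.+1 => //; rewrite ge_max !le_max lexx /=.
  by rewrite excess_eq// eq_cb.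
rewrite ge_max => /andP[_]; rewrite le_max => /orP[|].
  by rewrite leNgt e0.
rewrite [leRHS]/excess.
by have := psum_le m c y0 (ltnW nj); have := y0 (m + j)%N; lra.
Qed.

Lemma psum_ends_in_zeros (R : realType) (y : nat -> R) m c :
  (forall k, 0 <= y k) -> ends_in_zeros c -> represents y m c ->
  exists N, forall n, (N <= n)%N -> psum y m c n = y m.
Proof.
move=> y0 [N cN] [le_y sup_y]; exists N.
have psumN k : psum y m c (N + k) = psum y m c N.
  rewrite psumD [X in _ + X]big1 ?addr0// => j _.
  by rewrite /seq_tail cN ?mul0r// leq_addr.
suff yN : y m <= psum y m c N.
  by move=> n /subnKC <-; rewrite psumN; apply/eqP; rewrite eq_le le_y yN.
apply/ler_addgt0Pr => e e0; have [n ltn] := sup_y _ e0.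
by have := psum_le m c y0 (leq_addl N n); rewrite psumN; lra.
Qed.

(** Strict comparisons carry the excess to ever later indices. Once the nonzero digits of [c] have
    run out, the remainder is 0 and the excess is [- y (m + j)]. *)
Lemma excess_lt0 (R : realType) (y : nat -> R) (b : nat -> nat -> nat) m c i :
  (forall k, 0 < y k) -> represents y m c -> ends_in_zeros c ->
  (forall i, represents y i (b i)) ->
  (forall i, (0 < i)%N -> lex_lt (seq_tail i c) (b (m + i)%N)) ->
  (0 < i)%N -> excess y m c i < 0.
Proof.
move=> y_gt0 cm c0 bm cb i0; have y0 k : 0 <= y k by exact: ltW.
have [N cN] := psum_ends_in_zeros y0 c0 cm.
have [j j0|j Nj lej] := @nondecreasing_along _ (excess y m c) i _ i0 N.
  exact: excess_lt (bm _) (cb _ j0).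
by rewrite (le_lt_trans lej)// /excess cN ?(ltnW Nj)// subrr sub0r oppr_lt0.
Qed.

(** At the first difference [s] gains at least one unit of weight [y (m + n.+1)] over [c]. A
    negative excess of [c] thus makes [s] overshoot [y m]. *)
Lemma psum_lex_lt (R : realType) (y : nat -> R) m c s :
  (forall k, 0 <= y k) -> lex_lt c s -> exists n, y m <= psum y m s n.+1 + excess y m c n.+1.
Proof.
move=> y0 [n [eqn ltn]]; exists n; rewrite /excess !psumS (eq_psum _ _ eqn).
suff : (c n)%:R * y (m + n.+1)%N + y (m + n.+1)%N <=
    (s n)%:R * y (m + n.+1)%N by lra.
by rewrite -[X in _ + X]mul1r -mulrDl natr1 ler_wpM2r// ler_nat.
Qed.

Lemma lex_total c s : ~ lex_lt c s -> lex_le s c.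
Proof.
move=> ncs; have [[k]|] := pselect (exists k, s k != c k); last first.
  by move=> sc; right; apply/funext => k; apply/eqP/negPn/negP => ?; apply: sc; exists k.
move=> sck; left; have ex : exists k, s k != c k by exists k.
case: (ex_minnP ex) => n scn minn; have eqn j : (j < n)%N -> s j = c j.
  by move=> jn; apply/eqP/negPn/negP => /minn; rewrite leqNgt jn.
exists n; split=> //; rewrite ltnNge leq_eqVlt eq_sym (negbTE scn) /=.
by apply/negP => lt; apply: ncs; exists n; split=> // j /eqn.
Qed.

Lemma lex_max_ends_in_zeros (R : realType) (y : nat -> R) (b : nat -> nat -> nat) m c s :
  (forall k, 0 < y k) -> represents y m c -> ends_in_zeros c ->
  (forall i, represents y i (b i)) ->
  (forall i, (0 < i)%N -> lex_lt (seq_tail i c) (b (m + i)%N)) ->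
  represents y m s -> lex_le s c.
Proof.
move=> y_gt0 cm c0 bm cb [le_y _]; apply: lex_total => cs.
have [n] := psum_lex_lt m (fun k => ltW (y_gt0 k)) cs.
have := excess_lt0 y_gt0 cm c0 bm cb (ltn0Sn n); have := le_y n.+1; lra.
Qed.

Lemma lex_max_not_ends_in_zeros (R : realType) (y : nat -> R) (b : nat -> nat -> nat) m c s :
  (forall k, 0 < y k) -> represents y m c ->
  (forall i, represents y i (b i)) ->
  (forall i, (0 < i)%N -> lex_le (seq_tail i c) (b (m + i)%N)) ->
  ~ ends_in_zeros s -> represents y m s -> lex_le s c.
Proof.
move=> y_gt0 cm bm cb s0 [le_y _]; have y0 k : 0 <= y k by exact: ltW.
apply: lex_total => cs; have [n] := psum_lex_lt m y0 cs.
have := excess_le0 y0 cm bm cb (ltn0Sn n).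
(* So far the partial sum of [s] is only known to reach [y m]; a later nonzero digit pushes it
   strictly above. *)
have [k nk sk] : exists2 k, (n < k)%N & (0 < s k)%N.
  apply: contrapT => nex; apply: s0; exists n.+1 => k nk.
  by apply/eqP; rewrite -leqn0 leqNgt; apply/negP => sk; apply: nex; exists k.
have := le_y k.+1; have := psum_le m s y0 nk; rewrite [psum _ _ _ k.+1]psumS.
have : 0 < (s k)%:R * y (m + k.+1)%N by rewrite mulr_gt0// ltr0n.
lra.
Qed.

(** * Existence of the weights *)

(* [s] is the inverse of the product of the base over a period. *)
Definition supersolution (R : realType) (p : nat) (b : nat -> nat -> nat)
    (d s : R) (y : nat -> R) :=
  [/\ forall m, 0 < y m, forall m, y (m + p)%N = s * y m &
      forall m n, psum y m (b m) n <= (1 - d) * y m].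

Lemma psum_scale (R : realType) p b (s : R) (y : nat -> R) m k n :
  (forall m, y (m + p)%N = s * y m) -> (forall m, b (m + p)%N = b m) ->
  y (m + k * p)%N = s ^+ k * y m /\
  psum y (m + k * p) (b (m + k * p)%N) n = s ^+ k * psum y m (b m) n.
Proof.
move=> yp bp; have ykp m' : y (m' + k * p)%N = s ^+ k * y m'.
  elim: k => [|k IH]; first by rewrite addn0 mul1r.
  by rewrite mulSn (addnC p) addnA yp IH mulrA exprS.
have -> : b (m + k * p)%N = b m.
  by elim: k {ykp} => [|k IH]; rewrite ?addn0// mulSn (addnC p) addnA bp.
split=> //; rewrite /psum big_distrr /=; apply: eq_bigr => j _.
by rewrite addnAC ykp mulrCA.
Qed.

(** With ratio [r = 1 / (C + 1)], the relation [C * r = 1 - r] makes the worst case telescope. This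
    provides a first supersolution. *)
Lemma psum_geometric (R : realType) (C m n : nat) (c : nat -> nat) :
  (forall j, (c j <= C)%N) ->
  psum (fun m => (C.+1%:R : R)^-1 ^+ m) m c n <= (C.+1%:R)^-1 ^+ m.
Proof.
move=> cC; set r : R := (C.+1%:R)^-1.
have r0 : 0 <= r by rewrite invr_ge0.
have rE : C%:R * r = 1 - r.
  by rewrite /r -natr1; field; rewrite natr1 pnatr_eq0.
suff : psum (fun m => r ^+ m) m c n <= r ^+ m * (1 - r ^+ n).
  by move/le_trans; apply; rewrite ler_piMr ?exprn_ge0// gerBl exprn_ge0.
elim: n => [|n IH]; first by rewrite /psum big_ord0 expr0 subrr mulr0.
rewrite psumS (le_trans (lerD IH (_ : _ <= C%:R * r ^+ (m + n.+1))))//.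
  by rewrite ler_wpM2r ?exprn_ge0// ler_nat.
by rewrite exprD exprS !mulrA (mulrAC _ _ r) rE; lra.
Qed.

Lemma supersolution_le (R : realType) p b (d s : R) (y : nat -> R) m i :
  (forall m, (0 < b m 0)%N) -> 0 <= d < 1 -> supersolution p b d s y ->
  y (m + i)%N <= (1 - d) ^+ i * y m.
Proof.
move=> b0 d01 [y0 _ yb]; elim: i => [|i IH]; first by rewrite addn0 mul1r.
have le1 : y (m + i.+1)%N <= psum y (m + i) (b (m + i)%N) 1.
  by rewrite /psum big_ord1 addn1 addnS ler_peMl ?ler1n ?b0// ltW.
rewrite (le_trans le1)// (le_trans (yb _ _))// exprS -mulrA ler_wpM2l//.
by lra.
Qed.

(** Convexity of the power function: its graph lies below the chord between [1] and [1 + d]. *)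
Lemma expr_convex (R : realType) (d t : R) k :
  0 <= d -> 0 <= t <= 1 -> (1 + t * d) ^+ k <= 1 - t + t * (1 + d) ^+ k.
Proof.
move=> d0 t01; elim: k => [|k IH]; first by rewrite !expr0; lra.
rewrite !exprS (le_trans (ler_wpM2l _ IH))//; first by nra.
have : 0 <= (1 + d) ^+ k - 1 by rewrite subr_ge0 exprn_ege1// lerDl.
move: ((1 + d) ^+ k) => r r1.
have : 0 <= t * d * (1 - t) * (r - 1) by rewrite !mulr_ge0//; lra.
by lra.
Qed.

(* Slack [d > 0] everywhere makes [y] decay geometrically, so [y] can be replaced by
   [tau ^+ m * y m] for some [tau > 1]. *)
Lemma supersolution_increase (R : realType) p b (C : nat) (d s : R) (y : nat -> R) :
  (0 < p)%N -> (forall m, (0 < b m 0)%N) -> (forall m j, (b m j <= C)%N) ->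
  0 < d < 1 -> 0 < s -> supersolution p b d s y ->
  exists s' y', s < s' /\ supersolution p b 0 s' y'.
Proof.
move=> p0 b0 bC d01 s0 ys; have [y0 yp yb] := ys.
(* Since [t * C <= d ^ 3], the added terms, a geometric series of ratio [1 - d ^ 2], total at most
   [t * C * y m / d ^ 2 <= d * y m], which is the available slack. *)
pose t := d ^+ 3 / C.+1%:R; pose tau := 1 + t * d.
have [d0 d1] := andP d01.
have t0 : 0 < t by rewrite divr_gt0// exprn_gt0.
have t1 : t <= 1.
  by rewrite ler_pdivrMr// mul1r (@le_trans _ _ 1) ?ler1n// exprn_ile1// ltW.
have tau1 : 1 < tau by rewrite ltrDl mulr_gt0.
have tau0 : 0 < tau by apply: lt_trans tau1.
exists (s * tau ^+ p), (fun m => tau ^+ m * y m); split.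
  by rewrite ltr_pMr// exprn_egt1// -lt0n.
split=> [m|m|m n].
- by rewrite mulr_gt0// exprn_gt0.
- by rewrite yp exprD; ring.
rewrite subr0 mul1r.
suff : psum (fun m => tau ^+ m * y m) m (b m) n <= tau ^+ m *
    (psum y m (b m) n + t * C%:R * y m * ((1 - (1 - d ^+ 2) ^+ n) / d ^+ 2)).
  move/le_trans; apply; rewrite ler_pM2l ?exprn_gt0//.
  have Cn : t * C%:R <= d ^+ 3.
    by rewrite /t mulrAC ler_pdivrMr// ler_pM2l ?exprn_gt0// ler_nat.
  have G : (1 - (1 - d ^+ 2) ^+ n) / d ^+ 2 <= (d ^+ 2)^-1.
    rewrite ler_pdivrMr ?exprn_gt0// mulVf ?gt_eqF ?exprn_gt0//.
    by rewrite gerBl exprn_ge0// subr_ge0 exprn_ile1// ltW.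
  rewrite (le_trans (lerD (yb _ _) (_ : _ <= d * y m)))//; last by lra.
  rewrite mulrAC ler_pM2r//.
  rewrite (le_trans (ler_wpM2l _ G))//; first by rewrite mulr_ge0// ltW.
  by rewrite ler_pdivrMr ?exprn_gt0// -exprS.
elim: n => [|n IH]; first by rewrite /psum !big_ord0 expr0 subrr mul0r mulr0 addr0 mulr0.
rewrite !psumS (le_trans (lerD IH (lexx _)))// exprD.
rewrite -(mulrA (tau ^+ m) (tau ^+ _)) (mulrCA _ (tau ^+ m)) -mulrDr.
rewrite ler_pM2l ?exprn_gt0//.
(* The chord bound replaces [tau] by [1 + d], whose growth is offset by the decay of [y] at rate
   [1 - d]. *)
have le1 : tau ^+ n.+1 * y (m + n.+1)%N <=
    y (m + n.+1)%N + t * (1 - d ^+ 2) ^+ n * y m.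
  rewrite (le_trans (ler_wpM2r (ltW (y0 _)) (expr_convex _ _ _)))//; [exact: ltW|lra|].
  have le2 : y (m + n.+1)%N <= (1 - d) ^+ n.+1 * y m.
    by apply: supersolution_le ys => //; rewrite d1 ltW.
  have : (1 + d) ^+ n.+1 * y (m + n.+1)%N <= (1 - d ^+ 2) ^+ n * y m.
    rewrite (le_trans (ler_wpM2l _ le2))//; first by rewrite exprn_ge0//; lra.
    rewrite mulrA -exprMn ler_pM2r//.
    rewrite (_ : (1 + d) * (1 - d) = 1 - d ^+ 2); last by ring.
    rewrite exprS ler_piMl ?exprn_ge0//; last by rewrite gerBl exprn_ge0// ltW.
    by rewrite subr_ge0 exprn_ile1// ltW.
  move=> /(ler_wpM2l (ltW t0)); have := y0 (m + n.+1)%N; nra.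
have le3 : (b m n)%:R * (tau ^+ n.+1 * y (m + n.+1)%N) <=
   (b m n)%:R * y (m + n.+1)%N + t * C%:R * y m * (1 - d ^+ 2) ^+ n.
  rewrite (le_trans (ler_wpM2l _ le1))// mulrDr lerD2l.
  rewrite (_ : t * C%:R * y m * _ = C%:R * (t * (1 - d ^+ 2) ^+ n * y m)); last by ring.
  rewrite ler_wpM2r ?ler_nat// mulr_ge0 ?(ltW (y0 _))// mulr_ge0 ?(ltW t0)// exprn_ge0//.
  by rewrite subr_ge0 exprn_ile1// ltW.
rewrite (le_trans (lerD (lexx _) le3))// (exprS (1 - d ^+ 2)).
move: ((1 - d ^+ 2) ^+ n) => r; rewrite le_eqVlt; apply/orP; left; apply/eqP; field.
by rewrite gt_eqF.
Qed.

Lemma ler_psum (R : realType) (y y' : nat -> R) m c n :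
  (forall k, y k <= y' k) -> psum y m c n <= psum y' m c n.
Proof. by move=> yy'; apply: ler_sum => j _; rewrite ler_wpM2l. Qed.

Lemma supersolution0_nonincr (R : realType) p b (s : R) (y : nat -> R) m i :
  (forall m, (0 < b m 0)%N) -> supersolution p b 0 s y -> y (m + i)%N <= y m.
Proof.
move=> b0 ys; have := supersolution_le m i b0 _ ys.
by rewrite lexx ltr01 subr0 expr1n mul1r; exact.
Qed.

(* Decreasing [y] slightly at the indices where the inequality is strict keeps it
   strict there, and makes it strict at the preceding indices. *)
Lemma supersolution_strict (R : realType) p b (s d : R) (y : nat -> R) c :
  (0 < p)%N -> (forall m, (0 < b m 0)%N) -> (forall m, b (m + p)%N = b m) ->
  0 < s <= 1 -> 0 < d < 1 ->
  supersolution p b 0 s y -> (forall n, psum y c (b c) n <= (1 - d) * y c) ->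
  exists d' y', 0 < d' < 1 /\ supersolution p b d' s y'.
Proof.
move=> p0 b0 bp /andP[s0 s1] d01 ys yc.
(* [T k m]: one of [m, ..., m + k - 1] is congruent to [c]. Strictness spreads backwards from [c],
   one residue per step of the induction on [k]. *)
pose T k m := [exists i : 'I_k, m + i == c %[mod p]].
suff H k : exists d' y', [/\ 0 < d' < 1, supersolution p b 0 s y' &
    forall m, T k.+1 m -> forall n, psum y' m (b m) n <= (1 - d') * y' m].
  have [d' [y' [d'01 [y0 yp _] yT]]] := H p; exists d', y'; split=> //.
  split=> // m; apply: yT; apply/existsP.
  (* As [p.-1] is [-1] modulo [p], this is the residue of [c - m]. *)
  have lp : ((c + m * p.-1) %% p < p.+1)%N by rewrite ltnS ltnW// ltn_pmod.
  exists (Ordinal lp) => /=; rewrite modnDmr addnCA -mulnS prednK//.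
  by rewrite addnC modnMDl.
elim: k => [|k {d y d01 ys yc} [d [y [d01 ys yT]]]].
  exists d, y; split=> // m /existsP[[i /=]]; rewrite ltnS leqn0 => /eqP ->.
  rewrite addn0 => /eqP mc n; have [y0 yp _] := ys.
  have [cE1 cE2] := psum_scale (c %% p) (c %/ p) n yp bp.
  have [mE1 mE2] := psum_scale (m %% p) (m %/ p) n yp bp.
  move: (yc n); rewrite {1 2 3}(divn_eq c p) addnC cE1 cE2.
  rewrite (mulrCA (1 - d)) ler_pM2l ?exprn_gt0// => lec.
  rewrite {1 2 3}(divn_eq m p) addnC mE1 mE2.
  by rewrite (mulrCA (1 - d)) ler_pM2l ?exprn_gt0// mc.
have [d0 d1] := andP d01; have [y0 yp yb] := ys.
pose y' m := if T k.+1 m then (1 - d / 2) * y m else y m.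
have y'y m : y' m <= y m.
  by rewrite /y'; case: ifP => // _; rewrite ler_piMl ?ltW//; lra.
have y'0 m : 0 < y' m by rewrite /y'; case: ifP => // _; rewrite mulr_gt0//; lra.
have Tp m : T k.+1 (m + p)%N = T k.+1 m.
  by apply: eq_existsb => i; rewrite addnAC modnDr.
(* At a newly strict index [m] the gain is at least [d / 2 * y m.+1], hence at least
   [d / 2 * y (m + p) = s * d / 2 * y m]. This dictates the new slack [s * d / 2]. *)
have sd : s * d / 2 <= d / 2 by rewrite -mulrA ler_piMl//; lra.
have sd0 : 0 < s * d / 2 by rewrite divr_gt0// mulr_gt0.
have yT' m n : T k.+1 m -> psum y' m (b m) n <= (1 - s * d / 2) * y' m.
  move=> Tm; rewrite (le_trans (ler_psum _ _ _ y'y))// (le_trans (yT _ Tm _))//.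
  rewrite /y' Tm mulrA ler_pM2r//.
  by have := y0 m; nra.
have yTS m n : T k.+1 m.+1 -> psum y' m (b m) n <= y m - s * d / 2 * y m.
  move=> Tm; have y'1 : y' m.+1 = y m.+1 - d / 2 * y m.+1 by rewrite /y' Tm; ring.
  have ys1 : s * d / 2 * y m <= d / 2 * y m.+1.
    rewrite (_ : _ * y m = d / 2 * (s * y m)); last by ring.
    rewrite ler_pM2l ?divr_gt0//.
    rewrite -yp -(prednK p0) addnS -addSn.
    exact: supersolution0_nonincr ys.
  case: n => [|n].
    rewrite /psum big_ord0; have := y0 m; nra.
  have := yb m n.+1; rewrite subr0 mul1r /psum !big_ord_recl /= addn1 y'1 => le1.
  have : \sum_(i < n) (b m (bump 0 i))%:R * y' (m + (bump 0 i).+1)%N <=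
         \sum_(i < n) (b m (bump 0 i))%:R * y (m + (bump 0 i).+1)%N.
    by apply: ler_sum => i _; rewrite ler_wpM2l.
  have : d / 2 * y m.+1 <= (b m 0)%:R * (d / 2 * y m.+1).
    by rewrite ler_peMl ?ler1n// mulr_ge0// ?ltW//; lra.
  by rewrite mulrBr; lra.
exists (s * d / 2), y'; split.
- by rewrite sd0 (le_lt_trans sd)//; lra.
- split=> // [m|m n]; first by rewrite /y' Tp yp; case: ifP => // _; rewrite mulrCA.
  rewrite subr0 mul1r; have [Tm|Tm] := boolP (T k.+1 m).
    by rewrite (le_trans (yT' _ _ Tm))// ler_piMl ?ltW//; lra.
  rewrite (le_trans (ler_psum _ _ _ y'y))// (le_trans (yb _ _))//.
  by rewrite subr0 mul1r /y' (negbTE Tm).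
- move=> m Tm n; have [Tm'|Tm'] := boolP (T k.+1 m); first exact: yT'.
  have y'm : y' m = y m by rewrite /y' (negbTE Tm').
  rewrite y'm mulrBl mul1r; apply: yTS.
  have /existsP[i mi] := Tm; case: (unliftP ord0 i) => [j|] iE.
    by apply/existsP; exists j; rewrite addSnnS; rewrite iE in mi.
  by case/negP: Tm'; apply/existsP; exists ord0; rewrite iE in mi.
Qed.

(** A quasi-periodic sequence as a point of a finite-dimensional space: the first [p] coordinates
    are its values on a period, the last one is the factor [s]. *)
Definition periodic_extension (R : realType) p (v : 'rV[R]_p.+1) (m : nat) : R :=
  v ord0 (inord (m %% p)) * v ord0 ord_max ^+ (m %/ p).

Lemma periodic_extension_continuous (R : realType) p m :
  continuous (fun v : 'rV[R]_p.+1 => periodic_extension v m).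
Proof.
move=> v.
have c1 : {for v, continuous (fun v : 'rV[R]_p.+1 => v ord0 (inord (m %% p)))}.
  exact: coord_continuous.
have c2 : {for v, continuous (fun v : 'rV[R]_p.+1 => v ord0 ord_max ^+ (m %/ p))}.
  apply: (@continuous_comp _ _ _ (fun v : 'rV[R]_p.+1 => v ord0 ord_max)
    (fun x : R => x ^+ (m %/ p))).
    exact: coord_continuous.
  exact: exprn_continuous.
exact: (continuousM c1 c2).
Qed.

Lemma supersolution_max (R : realType) p b (C : nat) :
  (0 < p)%N -> (forall m, (0 < b m 0)%N) -> (forall m j, (b m j <= C)%N) ->
  exists (s : R) y, [/\ 0 < s <= 1, supersolution p b 0 s y &
    forall (s' : R) y', 0 < s' -> supersolution p b 0 s' y' -> s' <= s].
Proof.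
move=> p0 b0 bC.
(* Positivity is not a closed condition, so [A] only asks for coordinates in [[0, 1]], together with
   the normalisation [y 0 = 1] and the inequalities; positivity is recovered at the maximum. *)
pose A : set 'rV[R]_p.+1 :=
  [set v : 'rV[R]_p.+1 | forall i, `[0, 1]%classic (v ord0 i)] `&`
  ([set v : 'rV[R]_p.+1 | 1 <= v ord0 ord0] `&`
  \bigcap_(mn in [set: nat * nat]) [set v : 'rV[R]_p.+1 |
    0 <= periodic_extension v mn.1 -
         psum (periodic_extension v) mn.1 (b mn.1) mn.2]).
have clA : compact A.
  apply: (@subclosed_compact _ _ [set v : 'rV[R]_p.+1 | forall i, `[0, 1]%classic (v ord0 i)]);
    last by move=> v [].
    apply: closedI.
      rewrite (_ : [set _ | _] = \bigcap_(i in [set: 'I_p.+1])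
          [set v : 'rV[R]_p.+1 | `[0, 1]%classic (v ord0 i)]).
        apply: closed_bigI => i _.
        apply: (@preimage_closed _ _ (fun v : 'rV[R]_p.+1 => v ord0 i)).
          by move=> v _; exact: coord_continuous.
        exact: interval_closed.
      by apply/seteqP; split=> v /= vi i => [_|]; exact: vi.
    apply: closedI.
      apply: (@preimage_closed _ _ (fun v : 'rV[R]_p.+1 => v ord0 ord0) [set x | 1 <= x]).
        by move=> v _; exact: coord_continuous.
      exact: closed_ge.
    apply: closed_bigI => -[m n] _ /=.
    apply: (@preimage_closed _ _ (fun v : 'rV[R]_p.+1 => periodic_extension v m -
         psum (periodic_extension v) m (b m) n) [set x | 0 <= x]).
      have cS : continuous (fun v : 'rV[R]_p.+1 => psum (periodic_extension v) m (b m) n).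
        apply: continuous_big => [|j _ v]; first exact: add_continuous.
        apply: (@continuousM R _ (fun=> (b m j)%:R) (fun v => periodic_extension v _)).
          exact: cst_continuous.
        exact: periodic_extension_continuous.
      move=> v _; exact: (continuousB (@periodic_extension_continuous _ _ _ v) (cS v)).
    exact: closed_ge.
  apply: (@rV_compact R p.+1 (fun=> `[0, 1]%classic)) => i; exact: segment_compact.
have inA s y : 0 < s -> supersolution p b 0 s y ->
    exists2 v, v \in A & v ord0 ord_max = s.
  move=> s0 ys; have [y0 yp yb] := ys.
  pose v : 'rV[R]_p.+1 := \row_i if (i < p)%N then y i / y 0%N else s.
  have vE m : periodic_extension v m = y m / y 0%N.
    have mp : (m %% p < p)%N by rewrite ltn_pmod.
    rewrite /periodic_extension !mxE inordK ?mp ?ltnS ?(ltnW mp)//= ltnn.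
    rewrite {3}(divn_eq m p) addnC; move: (m %/ p)%N => k.
    elim: k => [|k IH]; first by rewrite addn0 mulr1.
    by rewrite mulSn (addnC p) addnA yp exprSr mulrA IH; ring.
  exists v; last by rewrite mxE /= ltnn.
  apply/mem_set; split.
    move=> i /=; rewrite in_itv /= mxE; case: ifP => _.
      rewrite divr_ge0 ?(ltW (y0 _))//= ler_pdivrMr// mul1r.
      by rewrite -[X in y X]add0n (supersolution0_nonincr _ _ b0 ys).
    by rewrite (ltW s0)/= -(ler_pM2r (y0 0%N)) -yp mul1r (supersolution0_nonincr _ _ b0 ys).
  split; first by rewrite /= mxE /= p0 divff// gt_eqF.
  move=> [m n] _ /=; rewrite vE /psum.
  under eq_bigr do rewrite vE mulrA.
  rewrite -mulr_suml -mulrBl divr_ge0 ?(ltW (y0 _))// subr_ge0.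
  by have := yb m n; rewrite subr0 mul1r.
(* The geometric supersolution shows that [A] is nonempty and that the maximal [s] is at least
   [r ^ p], hence positive. *)
pose r : R := C.+1%:R^-1; have r0 : 0 < r by rewrite invr_gt0.
have [v0 v0A v0E] : exists2 v, v \in A & v ord0 ord_max = r ^+ p.
  apply: (inA _ (fun m => r ^+ m)); first by rewrite exprn_gt0.
  split=> [m|m|m n]; [by rewrite exprn_gt0|by rewrite exprD mulrC|].
  by rewrite subr0 mul1r psum_geometric.
have [||v /set_mem vA vmax] := @EVT_max_rV R _ (fun v : 'rV[R]_p.+1 => v ord0 ord_max) A _ clA.
- by exists v0; exact: set_mem.
- by apply: continuous_subspaceT => v; exact: coord_continuous.
have {v0 v0A v0E} s0 : 0 < v ord0 ord_max.
  by rewrite (lt_le_trans _ (vmax _ v0A))// v0E exprn_gt0.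
exists (v ord0 ord_max), (periodic_extension v).
case: vA => v01 [v1 vb].
have yb m n : psum (periodic_extension v) m (b m) n <= periodic_extension v m.
  by rewrite -subr_ge0; exact: (vb (m, n)).
have y0 m : 0 <= periodic_extension v m.
  rewrite mulr_ge0 ?exprn_ge0 ?(ltW s0)//.
  by have := v01 (inord (m %% p)); rewrite /= in_itv => /andP[].
(* The sequence is nonincreasing, and at the multiple [m * p] of the period it is at least
   [s ^ m]. *)
have y_gt0 m : 0 < periodic_extension v m.
  have y_le i : periodic_extension v (m + i) <= periodic_extension v m.
    elim: i => [|i IH]; first by rewrite addn0.
    rewrite (le_trans _ IH)// (le_trans _ (yb _ 1%N))//.
    by rewrite /psum big_ord1 addn1 addnS ler_peMl ?ler1n.
  rewrite (lt_le_trans _ (y_le (m * p - m)%N))// subnKC; last by rewrite leq_pmulr.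
  rewrite /periodic_extension modnMl mulnK// mulr_gt0 ?exprn_gt0//.
  rewrite (lt_le_trans ltr01)// (le_trans v1)// le_eqVlt; apply/orP; left.
  by apply/eqP; congr (v _ _); apply/val_inj; rewrite /= inordK.
split.
- by rewrite s0; have := v01 ord_max; rewrite /= in_itv => /andP[].
- split=> // [m|m n]; last by rewrite subr0 mul1r.
  by rewrite /periodic_extension modnDr divnDr ?dvdnn// divnn p0 addn1 exprS mulrCA.
- by move=> s' y' s'0 /inA-/(_ s'0)[v' v'A <-]; exact: vmax.
Qed.

Lemma represents_exists (R : realType) p b (C : nat) :
  (0 < p)%N -> (forall m, (0 < b m 0)%N) -> (forall m j, (b m j <= C)%N) ->
  (forall m, b (m + p)%N = b m) ->
  exists (s : R) y, [/\ forall m, 0 < y m, forall m, y (m + p)%N = s * y m &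
    forall m, represents y m (b m)].
Proof.
move=> p0 b0 bC bp; have [s [y [s01 ys smax]]] := supersolution_max R p0 b0 bC.
have [s0 s1] := andP s01; have [y0 yp yb] := ys.
exists s, y; split=> // m; split=> [n|e e0]; first by have := yb m n; rewrite subr0 mul1r.
apply: contrapT => nex.
(* A gap [e] below [y m] is a relative slack [e / y m]; the cap [1 / 2] ensures [d < 1]. *)
pose d := Num.min (e / y m) (1 / 2).
have d01 : 0 < d < 1.
  rewrite lt_min divr_gt0//= divr_gt0//=.
  by rewrite gt_min; apply/orP; right; lra.
have dm n : psum y m (b m) n <= (1 - d) * y m.
  rewrite leNgt; apply/negP => lt; apply: nex; exists n.
  rewrite (le_lt_trans _ lt)// mulrBl mul1r lerB//.
  by rewrite -ler_pdivlMr// ge_min lexx.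
have [d' [y' [d'01 ys']]] := supersolution_strict p0 b0 bp s01 d01 ys dm.
have [s' [y'' [ss' ys'']]] := supersolution_increase p0 b0 bC d'01 s0 ys'.
by have := smax _ _ (lt_trans s0 ss') ys''; rewrite leNgt ss'.
Qed.

(** * Values of expansions in a periodic base *)

Lemma nneseries_eqP (R : realType) (u : nat -> R) (l : R) :
  (forall k, 0 <= u k) ->
  (\sum_(0 <= j <oo) (u j)%:E)%E = l%:E <->
  (forall n, \sum_(j < n) u j <= l) /\
  forall e, 0 < e -> exists n, l - e < \sum_(j < n) u j.
Proof.
move=> u0; have psE n : (\sum_(0 <= j < n) (u j)%:E)%E = (\sum_(j < n) u j)%:E.
  by rewrite sumEFin big_mkord.
have -> : (\sum_(0 <= j <oo) (u j)%:E)%E =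
          ereal_sup (range (fun n => (\sum_(j < n) u j)%:E)).
  apply/cvg_lim => //; under eq_fun do rewrite psE.
  apply: ereal_nondecreasing_cvgn => m n mn; rewrite -!psE.
  by apply: ereal_nondecreasing_series => // k _ _; rewrite lee_fin.
split=> [supE|[ub lub]].
  split=> [n|e e0].
    by rewrite -lee_fin -supE; apply: ereal_sup_ubound; exists n.
  have : ((l - e)%:E < ereal_sup (range (fun n => (\sum_(j < n) u j)%:E)))%E.
    by rewrite supE lte_fin ltrBlDr ltrDl.
  by move=> /ereal_sup_gt[_ [n _ <-]]; rewrite lte_fin => lt; exists n.
apply/eqP; rewrite eq_le; apply/andP; split.
  by apply: ge_ereal_sup => _ [n _ <-]; rewrite lee_fin.
apply/lee_addgt0Pr => e e0; have [n ltn] := lub _ e0.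
rewrite -leeBlDr//; apply: le_trans (_ : (\sum_(j < n) u j)%:E <= _)%E.
  by rewrite lee_fin ltW.
by apply: ereal_sup_ubound; exists n.
Qed.

(** By Bernoulli's inequality the products grow at least linearly. *)
Lemma prod_cvgy (R : realType) (u : nat -> R) (d : R) :
  1 < d -> (forall k, d <= u k) -> \prod_(1 <= k < N.+1) u k @[N --> \oo] --> +oo.
Proof.
move=> d1 du; apply/cvgryPge => A.
have le1 N : 1 + N%:R * (d - 1) <= \prod_(1 <= k < N.+1) u k.
  elim: N => [|N IH]; first by rewrite big_geq// mul0r addr0.
  rewrite big_nat_recr//= (le_trans _ (ler_pM _ _ IH (du _)))//.
  - have : 0 <= N%:R * (d - 1) * (d - 1).
      by rewrite !mulr_ge0// subr_ge0 ltW.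
    by rewrite -natr1; lra.
  - by rewrite addr_ge0// mulr_ge0// subr_ge0 ltW.
  - by rewrite ltW// (lt_trans ltr01).
exists (Num.bound `|A / (d - 1)|) => // N /= leN.
apply: le_trans (le1 N); apply: ler_wpDl => //.
rewrite -ler_pdivrMr ?subr_gt0// (le_trans (ler_norm _))// ltW//.
by rewrite (lt_le_trans (archi_boundP (normr_ge0 _)))// ler_nat.
Qed.

Lemma represents_scale (R : realType) (y : nat -> R) k m c :
  0 < k -> represents y m c -> represents (fun n => k * y n) m c.
Proof.
move=> k0 [le_y sup_y].
have psE n : psum (fun n => k * y n) m c n = k * psum y m c n.
  by rewrite /psum big_distrr /=; apply: eq_bigr => j _; rewrite mulrCA.
split=> [n|e e0]; first by rewrite psE ler_pM2l.
have [n ltn] := sup_y (e / k) (divr_gt0 e0 k0); exists n.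
by rewrite psE; move: ltn; rewrite -(ltr_pM2l k0) mulrBr mulrCA divff ?mulr1// gt_eqF.
Qed.

(** Either the first digit is at least 2, or it is 1 and a later digit is positive; in both cases a
    partial sum exceeds [y m.+1]. *)
Lemma represents_lt (R : realType) (y : nat -> R) m c :
  (forall k, 0 < y k) -> lex_lt one_zeros c -> represents y m c ->
  y m.+1 < y m.
Proof.
move=> y_gt0 [n [eqn ltn]] [le_y _]; have y0 k : 0 <= y k by exact: ltW.
have p1 : psum y m c 1 = (c 0%N)%:R * y m.+1 by rewrite /psum big_ord1 addn1.
case: n => [|n] in eqn ltn.
  by rewrite (lt_le_trans _ (le_y 1%N))// p1 ltr_pMl// ltr1n.
rewrite (lt_le_trans _ (le_y n.+2))// psumS.
rewrite (le_lt_trans (_ : _ <= psum y m c n.+1))//.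
  by rewrite (le_trans _ (psum_le m c y0 (ltn0Sn n)))// p1 -(eqn 0%N)// mul1r.
by rewrite ltrDl mulr_gt0// ltr0n.
Qed.

Definition weight (R : realType) (B : int -> R) (m : nat) : R :=
  \prod_(k < m) (B (- k.+1%:Z))^-1.

Lemma shift_baseZ (R : realType) (B : int -> R) (p : nat) (n k : int) :
  shift_base p%:Z B = B -> B (n + k * p%:Z) = B n.
Proof.
move=> Bp; have Bn m : B (m + p%:Z) = B m by rewrite -[RHS](congr1 (@^~ m) Bp).
have Bk m (j : nat) : B (m + j%:Z * p%:Z) = B m.
  elim: j => [|j IH]; first by rewrite mul0r addr0.
  by rewrite -IH -[RHS]Bn; congr B; rewrite intS; ring.
case: k => k; first exact: Bk.
by rewrite NegzE -[LHS](Bk _ k.+1); congr B; rewrite mulNr subrK.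
Qed.

Lemma weight_gt0 (R : realType) (B : int -> R) m : (forall n, 1 < B n) -> 0 < weight B m.
Proof. by move=> B1; apply: prodr_gt0 => k _; rewrite invr_gt0 (lt_trans ltr01). Qed.

Lemma weightS (R : realType) (B : int -> R) m :
  weight B m.+1 = weight B m / B (- m.+1%:Z).
Proof. by rewrite /weight big_ord_recr. Qed.

Lemma weightD (R : realType) (B : int -> R) p m :
  shift_base p%:Z B = B -> weight B (m + p) = weight B p * weight B m.
Proof.
move=> Bp; elim: m => [|m IH]; first by rewrite /weight big_ord0 mulr1.
rewrite addSn !weightS IH mulrA; congr (_ / _).
rewrite -[LHS](shift_baseZ _ 1 Bp); congr B; lia.
Qed.

(** Modulo the period, shifting by [i] amounts to shifting by [-m], so the product runs over the
    factors that separate two weights. *)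
Lemma prod_shift_base (R : realType) (B : int -> R) p i m j :
  (forall n, 1 < B n) -> shift_base p%:Z B = B -> (p %| i + m)%N ->
  \prod_(1 <= k < j.+1) shift_base i%:Z B (- k%:Z) = weight B m / weight B (m + j).
Proof.
move=> B1 Bp /dvdnP[q im]; elim: j => [|j IH].
  by rewrite big_geq// addn0 divff// gt_eqF// weight_gt0.
have Bn0 n : B n != 0 by rewrite gt_eqF// (lt_trans ltr01).
rewrite big_nat_recr//= IH addnS weightS invfM invrK mulrA; congr (_ * _).
rewrite /shift_base -(shift_baseZ (- (m + j).+1%:Z) q%:Z Bp); congr B; lia.
Qed.

Lemma val_frac_represents (R : realType) (B : int -> R) p i m c :
  (forall n, 1 < B n) -> shift_base p%:Z B = B -> (p %| i + m)%N ->
  val_frac (shift_base i%:Z B) c = 1%E <-> represents (weight B) m c.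
Proof.
move=> B1 Bp im; have w0 k := weight_gt0 k B1.
pose u j := (c j)%:R * weight B (m + j.+1) / weight B m.
have -> : val_frac (shift_base i%:Z B) c = (\sum_(0 <= j <oo) (u j)%:E)%E.
  apply: eq_eseriesr => j _; rewrite (prod_shift_base _ B1 Bp im).
  by rewrite invfM invrK /u mulrA mulrAC.
have uE n : \sum_(j < n) u j = psum (weight B) m c n / weight B m.
  by rewrite /psum mulr_suml.
rewrite nneseries_eqP; last first.
  by move=> j; rewrite divr_ge0 ?(ltW (w0 _))// mulr_ge0// ltW.
split=> -[ub lub]; split.
- by move=> n; have := ub n; rewrite uE ler_pdivrMr// mul1r.
- move=> e e0; have [n ltn] := lub _ (divr_gt0 e0 (w0 m)); exists n.
  by move: ltn; rewrite uE ltr_pdivlMr// mulrBl mul1r divfK// gt_eqF.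
- by move=> n; rewrite uE ler_pdivrMr// mul1r.
- move=> e e0; have [n ltn] := lub _ (mulr_gt0 e0 (w0 m)); exists n.
  by move: ltn; rewrite uE ltr_pdivlMr// mulrBl mul1r.
Qed.

(** * ** * Uniqueness of the weights up to proportionality *)

(** Both series have the same sum [k * y m] and are compared term by term, so a strict inequality in
    the first term, whose digit is positive, could not be made up for. *)
Lemma represents_propagate (R : realType) (y y' : nat -> R) k m c :
  (forall m, 0 <= y' m) -> (forall m, y' m <= k * y m) -> (0 < c 0)%N -> 0 <= k ->
  represents y m c -> represents y' m c -> y' m = k * y m ->
  y' m.+1 = k * y m.+1.
Proof.
move=> y'0 y'y c0 k0 [le_y _] [_ sup_y'] y'm; apply/eqP; rewrite eq_le y'y leNgt /=.
apply/negP => lt1; pose e := k * y m.+1 - y' m.+1.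
have e0 : 0 < e by rewrite subr_gt0.
have [n] := sup_y' _ e0; apply/negP; rewrite -leNgt.
rewrite (le_trans (psum_le m c y'0 (leqnSn n)))//.
have : psum y' m c n.+1 <= k * psum y m c n.+1 - e.
  rewrite /psum !big_ord_recl /= addn1 mulrDr.
  have : \sum_(i < n) (c (bump 0 i))%:R * y' (m + (bump 0 i).+1)%N <=
         k * \sum_(i < n) (c (bump 0 i))%:R * y (m + (bump 0 i).+1)%N.
    by rewrite big_distrr; apply: ler_sum => i _ /=; rewrite mulrCA ler_wpM2l.
  have : e <= (c 0%N)%:R * e by rewrite ler_peMl ?ler1n// ltW.
  rewrite /e; lra.
have := ler_wpM2l k0 (le_y n.+1); rewrite y'm; lra.
Qed.

(** Take for [k] the maximum of [y' / y] over one period. Each further period multiplies the ratio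
    by [s' / s <= 1], so [k] bounds it everywhere, and equality propagates from the maximiser. *)
Lemma represents_proportional (R : realType) p (b : nat -> nat -> nat)
    (y y' : nat -> R) s s' :
  (0 < p)%N -> (forall m, (0 < b m 0)%N) ->
  (forall m, 0 < y m) -> (forall m, y (m + p)%N = s * y m) ->
  (forall m, represents y m (b m)) ->
  (forall m, 0 < y' m) -> (forall m, y' (m + p)%N = s' * y' m) ->
  (forall m, represents y' m (b m)) -> s' <= s ->
  exists k m0, forall m, (m0 <= m)%N -> y' m = k * y m.
Proof.
move=> p0 b0 y0 yp yb y'0 y'p y'b ss'.
have s'0 : 0 <= s' by rewrite -(pmulr_lge0 _ (y'0 0%N)) -y'p ltW.
pose i0 := Ordinal p0; pose F (i : 'I_p) := y' i / y i.
pose i := [arg max_(i > i0) F i]%O.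
have iP j : F j <= F i by rewrite /i; case: arg_maxP => // i' _ /(_ j); exact.
have k0 : 0 <= F i by rewrite divr_ge0// ltW.
have y'y m : y' m <= F i * y m.
  have mp : (m %% p < p)%N by rewrite ltn_pmod.
  rewrite (divn_eq m p) addnC; elim: (m %/ p)%N => [|q IH].
    by rewrite addn0 -ler_pdivrMr//; exact: (iP (Ordinal mp)).
  rewrite mulSn (addnC p) addnA y'p yp mulrCA ler_pM// ltW//.
exists (F i), i; move=> m /subnKC <-; elim: (m - i)%N => [|n IH].
  by rewrite addn0 divfK// gt_eqF.
rewrite addnS; apply: (represents_propagate _ y'y (b0 _) k0 (yb _) (y'b _) IH).
by move=> j; exact: ltW.
Qed.

(** * ** * Recovering a periodic base from its weights *)

Lemma weight_exists (R : realType) p (s : R) (y : nat -> R) :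
  (0 < p)%N -> (forall m, 0 < y m) -> (forall m, y m.+1 < y m) ->
  (forall m, y (m + p)%N = s * y m) ->
  exists B : int -> R, [/\ forall n, 1 < B n, shift_base p%:Z B = B &
    forall m, weight B m = (y 0%N)^-1 * y m].
Proof.
move=> p0 y0 ylt yp.
(* The requirement [B (- (m + 1)) = y m / y m.+1] means [m = - n - 1]. The quotient depends only on
   [m] modulo [p], since the powers of [s] cancel, and reducing [m] also defines [B] at nonnegative
   [n]. *)
pose idx (n : int) : nat := `|((- n - 1) %% p%:Z)%Z|%N.
pose B n := y (idx n) / y (idx n).+1.
exists B; split.
- by move=> n; rewrite /B ltr_pdivlMr// mul1r.
- apply/funext => n; rewrite /shift_base /B /idx.
  suff -> : (- (n + p%:Z) - 1 = - n - 1 %[mod p%:Z])%Z by [].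
  by apply/eqP; rewrite eqz_mod_dvd; apply/dvdzP; exists (-1); ring.
- elim=> [|m IH]; first by rewrite /weight big_ord0 mulVf// gt_eqF.
  rewrite weightS IH.
  have -> : B (- m.+1%:Z) = y m / y m.+1.
    have -> : B (- m.+1%:Z) = y (m %% p)%N / y (m %% p).+1.
      rewrite /B /idx; have -> : - - m.+1%:Z - 1 = m%:Z by lia.
      by rewrite modz_nat.
    rewrite {3 4}(divn_eq m p) (addnC (_ * _)%N) -addSn.
    elim: (m %/ p)%N => [|q IHq]; first by rewrite !addn0.
    rewrite mulSn (addnC p) !addnA !yp IHq invfM mulrACA divff ?mul1r//.
    by apply/eqP => s0; have := y0 (0 + p)%N; rewrite yp s0 mul0r ltxx.
  by field; rewrite !gt_eqF.
Qed.

Lemma weight_inj (R : realType) p (B B' : int -> R) k m0 :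
  (0 < p)%N -> (forall n, 1 < B n) -> shift_base p%:Z B = B ->
  (forall n, 1 < B' n) -> shift_base p%:Z B' = B' ->
  (forall m, (m0 <= m)%N -> weight B' m = k * weight B m) -> B = B'.
Proof.
move=> p0 B1 Bp B'1 B'p BB'; apply/funext => n.
(* Going back [q] periods from [n] reaches a position [- (m + 1)] with [m >= m0], where the quotient
   of consecutive weights is free of [k]. *)
pose q := (m0 + `|n| + 1)%N; pose m := absz ((q * p)%N%:Z - n - 1)%R.
have qp : (q <= q * p)%N by rewrite leq_pmulr.
have mE : - m.+1%:Z = n + (- q%:Z) * p%:Z by rewrite mulNr -PoszM /m; lia.
have m0m : (m0 <= m)%N by rewrite /m; lia.
rewrite -(shift_baseZ n (- q%:Z) Bp) -(shift_baseZ n (- q%:Z) B'p) -mE.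
have := weightS B' m; rewrite !BB' ?(leqW m0m)// weightS.
have w0 : weight B m != 0 by rewrite gt_eqF// weight_gt0.
have k0 : k != 0.
  by apply: contraTneq (weight_gt0 m B'1) => k0; rewrite BB'// k0 mul0r ltxx.
by rewrite mulrA => /(mulfI (mulf_neq0 k0 w0)) /invr_inj.
Qed.

(* The residue of [-m] modulo [p], since [p - 1 = -1] modulo [p]. *)
Definition opp_ord p (hp : (0 < p)%N) (m : nat) : 'I_p :=
  Ordinal (ltn_pmod (m * p.-1) hp).

Lemma opp_ordP p (hp : (0 < p)%N) m : (p %| opp_ord hp m + m)%N.
Proof.
by rewrite /dvdn modnDml -mulnSr prednK// modnMl.
Qed.

Lemma opp_ord_unique p (hp : (0 < p)%N) m (k : 'I_p) :
  (p %| k + m)%N -> opp_ord hp m = k.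
Proof.
move=> km; apply/val_inj; rewrite -[LHS](modn_small (ltn_ord _)) -[RHS](modn_small (ltn_ord _)).
by apply/eqP; rewrite -(eqn_modDr m) (eqP (opp_ordP hp m)) (eqP km).
Qed.

(** A periodic base takes finitely many values, so it is bounded below by its minimum, which exceeds
    1. *)
Lemma cantor_real_base_periodic (R : realType) p (B : int -> R) :
  (0 < p)%N -> (forall n, 1 < B n) -> shift_base p%:Z B = B -> cantor_real_base B.
Proof.
move=> p0 B1 Bp.
have [d d1 dB] : exists2 d, 1 < d & forall n, d <= B n.
  pose i0 := Ordinal p0; pose i := [arg min_(j < i0) B j%:Z]%O.
  exists (B i%:Z) => // n.
  have n0 : (0 <= n %% p%:Z)%Z by rewrite modz_ge0//; lia.
  have np : (`|(n %% p%:Z)%Z|%N < p)%N.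
    by rewrite -ltz_nat gez0_abs// ltz_pmod.
  rewrite (divz_eq n p%:Z) addrC (shift_baseZ _ _ Bp) -(gez0_abs n0).
  by rewrite /i; case: arg_minP => // i' _ /(_ (Ordinal np)); exact.
by split=> //; exact: (prod_cvgy d1).
Qed.

Theorem theorem19 (R : realType) (p : nat) (hp : (0 < p)%N)
  (a : 'I_p -> nat -> nat)
  (ha : forall i : 'I_p, lex_lt one_zeros (a i))
  (hterm : forall i : 'I_p, ends_in_zeros (a i) ->
     forall (j : nat) (k : 'I_p), (1 <= j)%N ->
       (k%:Z = i%:Z - j%:Z %[mod p%:Z])%Z -> lex_lt (seq_tail j (a i)) (a k))
  (hnonterm : forall i : 'I_p, ~ ends_in_zeros (a i) ->
     forall (j : nat) (k : 'I_p), (1 <= j)%N ->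
       (k%:Z = i%:Z - j%:Z %[mod p%:Z])%Z -> lex_le (seq_tail j (a i)) (a k)) :
  (exists B : int -> R, has_prescribed_expansions a B) /\
  ((forall i : 'I_p, ultimately_periodic (a i)) ->
     exists! B : int -> R, has_prescribed_expansions a B) /\
  ((forall i : 'I_p, (1 < a i 0)%N) ->
     exists! B : int -> R, has_prescribed_expansions a B).
Proof.
pose b m := a (opp_ord hp m).
have bp m : b (m + p)%N = b m.
  by congr a; apply: opp_ord_unique; rewrite addnA dvdn_addl ?opp_ordP.
have idx_tail m j : (opp_ord hp (m + j) = (opp_ord hp m)%:Z - j%:Z %[mod p%:Z])%Z.
  apply/eqP; rewrite eqz_mod_dvd.
  have /dvdnP[q1 q1E] := opp_ordP hp (m + j).
  have /dvdnP[q2 q2E] := opp_ordP hp m.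
  by apply/dvdzP; exists (q1%:Z - q2%:Z); lia.
have b_lt m j : ends_in_zeros (b m) -> (0 < j)%N ->
    lex_lt (seq_tail j (b m)) (b (m + j)%N).
  by move=> bm j0; apply: hterm.
have b_le m j : (0 < j)%N -> lex_le (seq_tail j (b m)) (b (m + j)%N).
  move=> j0; have [bm|bm] := pselect (ends_in_zeros (b m)).
    by left; apply: b_lt.
  exact: hnonterm.
have b0 m : (0 < b m 0)%N.
  have [[|n] [eqn ltn]] := ha (opp_ord hp m); first exact: ltnW.
  by rewrite /b -(eqn 0%N).
(* Every digit starts a tail that is lexicographically at most some [b m'], so the largest first
   digit bounds all digits. *)
pose C := (\max_(i < p) a i 0)%N.
have bC m j : (b m j <= C)%N.
  have bC0 m' : (b m' 0 <= C)%N by exact: (leq_bigmax (F := fun i => a i 0)).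
  case: j => [//|j]; apply: leq_trans (bC0 (m + j.+1)%N).
  rewrite (_ : b m j.+1 = seq_tail j.+1 (b m) 0); last by rewrite /seq_tail addn0.
  have [[[|n] [eqn ltn]]|->//] := b_le m j.+1 (ltn0Sn j); first exact: ltnW.
  by rewrite eqn.
have weights B : has_prescribed_expansions a B ->
    [/\ forall n, 1 < B n, shift_base p%:Z B = B &
      forall m, represents (weight B) m (b m)].
  move=> [[[B1 _ _] Bp] aB]; split=> // m.
  apply/(val_frac_represents _ B1 Bp (opp_ordP hp m)).
  have [t1 t2] := aB (opp_ord hp m).
  have [/t1[]//|/t2[]//] := pselect (ends_in_zeros (b m)).
have ex : exists B : int -> R, has_prescribed_expansions a B.
  have [s [y [y0 yp yb]]] := represents_exists R hp b0 bC bp.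
  have ylt m : y m.+1 < y m by exact: represents_lt (ha _) (yb m).
  have [B [B1 Bp BE]] := weight_exists hp y0 ylt yp.
  have wb m : represents (weight B) m (b m).
    have -> : weight B = (fun m => (y 0%N)^-1 * y m) by apply/funext.
    by apply: represents_scale; rewrite ?invr_gt0.
  have w0 m : 0 < weight B m by exact: weight_gt0.
  exists B; split; first by split=> //; exact: cantor_real_base_periodic Bp.
  (* This [m] is [-i] modulo [p], so that [b m] is [a i]. *)
  move=> i; pose m := (i * p.-1)%N.
  have im : (p %| i + m)%N by rewrite /m -mulnS prednK// dvdn_mull.
  have bi : b m = a i by congr a; exact: opp_ord_unique.
  rewrite -bi; split=> bm0.
    split; first exact/(val_frac_represents _ B1 Bp im).
    move=> t /(val_frac_represents _ B1 Bp im) tm.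
    by apply: (lex_max_ends_in_zeros w0 (wb m) bm0 wb _ tm) => j; exact: b_lt.
  split=> //; first exact/(val_frac_represents _ B1 Bp im).
  move=> t t0 /(val_frac_represents _ B1 Bp im) tm.
  exact: (lex_max_not_ends_in_zeros w0 (wb m) wb (b_le m) t0 tm).
(* By [weightD], [weight B p] is the factor by which the weights of [B] are multiplied over a
   period; two such factors are always comparable. *)
have uniq (B B' : int -> R) : has_prescribed_expansions a B ->
    has_prescribed_expansions a B' -> weight B' p <= weight B p -> B = B'.
  move=> /weights[B1 Bp wb] /weights[B'1 B'p wb'] le.
  have w0 m : 0 < weight B m by exact: weight_gt0.
  have w'0 m : 0 < weight B' m by exact: weight_gt0.
  have [k [m0 kE]] := represents_proportional hp b0 w0
    (fun m => weightD m Bp) wb w'0 (fun m => weightD m B'p) wb' le.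
  exact: (weight_inj hp B1 Bp B'1 B'p kE).
have exU : exists! B : int -> R, has_prescribed_expansions a B.
  have [B aB] := ex; exists B; split=> // B' aB'.
  have [le|/ltW le] := leP (weight B' p) (weight B p); first exact: uniq.
  by apply/esym; exact: uniq.
by split; [|split].
Qed.
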